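(* Let $f\colon\mathbb{R}^d\to\mathbb{R}$ be differentiable, let $l_1,\dots,l_d>0$, and let $x\in\mathbb{R}^d$, $s\in\{-1,1\}^d$ and $\alpha>0$. Each of the following two assumptions on $f$ separately, (i) $f$ is separably smooth with constants $l_1,\dots,l_d$; (ii) $f$ is $\ell_\infty$-smooth with constant $L_\infty=\sum_{i=1}^d l_i$, implies $$f(x+\alpha s)\le f(x)+\alpha\langle\nabla f(x),s\rangle+\frac{\alpha^2}{2}\sum_{i=1}^d l_i .$$
   Context: A differentiable $f\colon\mathbb{R}^d\to\mathbb{R}$ is separably smooth with constants $l_1,\dots,l_d>0$ if for all $x,x'\in\mathbb{R}^d$, $$f(x')\le f(x)+\langle\nabla f(x),x'-x\rangle+\tfrac12\sum_{i=1}^d l_i(x'_i-x_i)^2 .$$ It is $\ell_\infty$-smooth with constant $L_\infty>0$ if $\Vert\nabla f(x')-\nabla f(x)\Vert_1\le L_\infty\Vert x'-x\Vert_\infty$ for all $x,x'\in\mathbb{R}^d$. *)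

(* Defs.v *)
From HB Require Import structures.
From mathcomp Require Import all_boot all_order all_algebra.
From mathcomp Require Import all_classical all_reals all_analysis.

Set Implicit Arguments.
Unset Strict Implicit.
Unset Printing Implicit Defensive.

Import Order.TTheory GRing.Theory Num.Theory.
Import numFieldNormedType.Exports.

Local Open Scope ring_scope.

(* Points of R^d are row vectors 'rV[R]_d. The library norm `|x| on them is
   the maximum of the absolute values of the entries, i.e. the l_infty norm. *)

Definition dotv (R : realType) (d : nat) (u v : 'rV[R]_d) : R :=
  \sum_(i < d) u 0 i * v 0 i.

Definition norm1 (R : realType) (d : nat) (u : 'rV[R]_d) : R :=
  \sum_(i < d) `|u 0 i|.

(* delta_mx 0 i is the i-th standard basis vector, so that the entries are the
   partial derivatives of f at x. *)
Definition gradient (R : realType) (d : nat) (f : 'rV[R]_d -> R)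
    (x : 'rV[R]_d) : 'rV[R]_d :=
  \row_(i < d) 'D_(delta_mx 0 i) f x.

Definition separably_smooth (R : realType) (d : nat) (l : 'I_d -> R)
    (f : 'rV[R]_d -> R) : Prop :=
  forall x x' : 'rV[R]_d,
    f x' <= f x + dotv (gradient f x) (x' - x)
            + 2^-1 * \sum_(i < d) l i * (x' 0 i - x 0 i) ^+ 2.

Definition linfty_smooth (R : realType) (d : nat) (L : R)
    (f : 'rV[R]_d -> R) : Prop :=
  forall x x' : 'rV[R]_d,
    norm1 (gradient f x' - gradient f x) <= L * `|x' - x|.

(* Main.v *)
(** For (i), instantiate the hypothesis at [x' = x + alpha s] and use
    [s_i ^ 2 = 1].  For (ii), the function
    [h |-> f (x + h s) - h <grad f x, s> - L h^2 / 2] has derivative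
    [<grad f (x + h s) - grad f x, s> - L h], which is nonpositive for
    [h >= 0] by the duality of the l_1 and l_infty norms; the mean value
    theorem on [0, alpha] concludes. *)
Require Import Defs.
From HB Require Import structures.
From mathcomp Require Import all_boot all_order all_algebra.
From mathcomp Require Import all_classical all_reals all_analysis.
From mathcomp Require Import lra.

Import Order.TTheory GRing.Theory Num.Theory.
Import numFieldNormedType.Exports.

Local Open Scope ring_scope.

Lemma dotvBl (R : realType) (d : nat) (u v w : 'rV[R]_d) :
  dotv (u - v) w = dotv u w - dotv v w.
Proof.
by rewrite /dotv -sumrB; apply: eq_bigr => i _; rewrite !mxE mulrBl.
Qed.

Lemma dotvZr (R : realType) (d : nat) (a : R) (u v : 'rV[R]_d) :
  dotv u (a *: v) = a * dotv u v.
Proof.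
by rewrite /dotv mulr_sumr; apply: eq_bigr => i _; rewrite !mxE mulrCA.
Qed.

(** Half of the duality between the l_1 and l_infty norms, obtained term by term from
    [u_i v_i <= |u_i| |v_i|]. *)
Lemma dotv_le_norm1 (R : realType) (d : nat) (u v : 'rV[R]_d) :
  (forall i, `|v 0 i| <= 1) -> dotv u v <= norm1 u.
Proof.
move=> v_le1; apply: ler_sum => i _; apply: le_trans (ler_norm _) _.
by rewrite normrM ler_piMr.
Qed.

(** The norm is an iterated maximum starting from 0, whence [0 <= c]; this also covers [d = 0]. *)
Lemma rV_norm_le (R : realType) (d : nat) (v : 'rV[R]_d) (c : R) :
  0 <= c -> (forall i, `|v 0 i| <= c) -> `|v| <= c.
Proof.
move=> c_ge0 v_le; rewrite -[`|v|]/(mx_norm v) mx_normrE.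
by apply/bigmax_leP; split => // -[i j] _ /=; rewrite ord1.
Qed.

(** The differential is linear, so it can be expanded along [v = sum_i v_i e_i]; its values at the
    basis vectors [e_i] are the partial derivatives. *)
Lemma derive_gradient (R : realType) (d : nat) (f : 'rV[R]_d -> R)
    (x v : 'rV[R]_d) :
  differentiable f x -> 'D_v f x = dotv (gradient f x) v.
Proof.
move=> f_diff; rewrite deriveE // {1}[v]row_sum_delta linear_sum /dotv.
by apply: eq_bigr => i _; rewrite linearZ mxE deriveE //= mulrC.
Qed.

(** Since [x + (h + t) v = h v + (x + t v)], both derivatives are limits of the same difference
    quotient, and no chain rule is needed. *)
Lemma is_derive_line (R : realType) (V W : normedModType R) (f : V -> W)
    (x v : V) (t : R) :
  differentiable f (x + t *: v) ->
  is_derive t 1 (fun h : R => f (x + h *: v)) ('D_v f (x + t *: v)).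
Proof.
move=> f_diff; have f_der : derivable f (x + t *: v) v by exact: diff_derivable.
have quotE : (fun h : R => h^-1 *: (f (x + (h *: 1 + t) *: v) - f (x + t *: v)))
           = (fun h : R => h^-1 *: (f (h *: v + (x + t *: v)) - f (x + t *: v))).
  apply/funext => h; congr (_ *: (f _ - _)).
  by rewrite [h *: 1]mulr1 scalerDl addrCA.
apply: DeriveDef; first by rewrite /derivable quotE.
by rewrite /derive quotE.
Qed.

Lemma separably_smooth_sign_step (R : realType) (d : nat) (f : 'rV[R]_d -> R)
    (x s : 'rV[R]_d) (l : 'I_d -> R) (alpha : R) :
  (forall i, s 0 i = -1 \/ s 0 i = 1) ->
  separably_smooth l f ->
  f (x + alpha *: s) <= f x + alpha * dotv (gradient f x) s
                        + alpha ^+ 2 / 2 * \sum_(i < d) l i.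
Proof.
move=> s_sign /(_ x (x + alpha *: s)); rewrite [x + _ - x]addrAC subrr add0r dotvZr.
(* The linear terms agree; cancelling 1/2 leaves a comparison of the quadratic sums, done coordinate
   by coordinate. *)
move=> /le_trans; apply; rewrite lerD2l -mulrA mulrCA ler_pM2l ?invr_gt0 //.
rewrite mulr_sumr; apply: ler_sum => i _; rewrite !mxE [x 0 i + _ - _]addrAC subrr add0r.
by case: (s_sign i) => ->; rewrite ?mulrN ?mulr1 ?sqrrN mulrC.
Qed.

(** Only [0 <= L] is assumed, because the sum of the [l i] is 0 when [d = 0]. *)
Lemma linfty_smooth_sign_step (R : realType) (d : nat) (f : 'rV[R]_d -> R)
    (x s : 'rV[R]_d) (L alpha : R) :
  (forall i, s 0 i = -1 \/ s 0 i = 1) ->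
  (forall y, differentiable f y) -> 0 <= L -> 0 < alpha ->
  linfty_smooth L f ->
  f (x + alpha *: s) <= f x + alpha * dotv (gradient f x) s
                        + alpha ^+ 2 / 2 * L.
Proof.
move=> s_sign f_diff L_ge0 alpha_gt0 f_smooth.
have s_le1 i : `|s 0 i| <= 1 by case: (s_sign i) => ->; rewrite ?normrN normr1.
(* As [psi 0 = f x], the claim is [psi alpha <= psi 0]. *)
set g := dotv (gradient f x) s.
pose psi (h : R) := f (x + h *: s) - (h * g + h ^+ 2 / 2 * L).
pose dpsi (h : R) := dotv (gradient f (x + h *: s)) s - (g + h * L).
have psi_der (h : R) : is_derive h 1 psi (dpsi h).
  have := @is_derive_line _ _ _ f x s h (f_diff _).
  rewrite derive_gradient // => line_der.
  apply: is_derive_eq; rewrite /dpsi /GRing.scale /=; lra.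
have psi_cont : {within `[0, alpha], continuous psi}%classic.
  apply: continuous_subspaceT => h; apply: differentiable_continuous.
  by apply/derivable1_diffP; have [] := psi_der h.
have [c /[!in_itv]/= /andP[c_gt0 _]] :=
  MVT alpha_gt0 (fun h _ => psi_der h) psi_cont.
(* The mean value theorem gave [psi alpha - psi 0 = dpsi c * (alpha - 0)], so only the sign of
   [dpsi c] matters. *)
suff dpsi_le0 : dpsi c <= 0.
  have := mulr_le0_ge0 dpsi_le0 (ltW alpha_gt0).
  rewrite /psi scale0r addr0 subr0 => + psiE; rewrite -psiE; lra.
rewrite /dpsi opprD addrA -dotvBl subr_le0.
apply: (le_trans (dotv_le_norm1 _ _ _ _ s_le1)).
apply: le_trans (f_smooth _ _) _.
rewrite [x + _ - x]addrAC subrr add0r mulrC ler_wpM2r //.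
(* The displacement from [x] is [c *: s], of l_infty norm at most [c] because the entries of [s] are
   signs. *)
rewrite normrZ gtr0_norm // (ler_piMr (ltW c_gt0)) //; exact: rV_norm_le.
Qed.

Theorem proposition2 (R : realType) (d : nat) (f : 'rV[R]_d -> R)
  (f_diff : forall y : 'rV[R]_d, differentiable f y)
  (l : 'I_d -> R) (l_gt0 : forall i : 'I_d, 0 < l i)
  (x s : 'rV[R]_d) (s_sign : forall i : 'I_d, s 0 i = -1 \/ s 0 i = 1)
  (alpha : R) (alpha_gt0 : 0 < alpha) :
  (separably_smooth l f ->
     f (x + alpha *: s) <= f x + alpha * dotv (gradient f x) s
                           + alpha ^+ 2 / 2 * \sum_(i < d) l i)
  /\
  (linfty_smooth (\sum_(i < d) l i) f ->
     f (x + alpha *: s) <= f x + alpha * dotv (gradient f x) s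
                           + alpha ^+ 2 / 2 * \sum_(i < d) l i).
Proof.
split; first exact: separably_smooth_sign_step.
apply: linfty_smooth_sign_step => //.
by apply: sumr_ge0 => i _; exact: ltW.
Qed.
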